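(* Let $E_1$, $E_2$ and $F$ be locally convex spaces, $r,s\in\mathbb{N}_0\cup\{\infty\}$, and let $f\colon U \times V \rightarrow F$ be a $C^{r,s}$-map on open subsets $U \subseteq E_1$, $V \subseteq E_2$. Let $i,j \in \mathbb{N}_0$ with $i\le r$, $j \le s$, let $x \in U$, $y \in V$, $w_1, \dots ,w_i \in E_1$ and $w_{i+1},\dots,w_{i+j} \in E_2$. Define $w_k^*:=(w_k,0)$ if $k \in \{1,\ldots,i\}$ and $w^*_k:=(0,w_k)$ if $k \in \{i+1,\ldots,i+j\}$. Let $\sigma \in S_{i+j}$ be a permutation of $\{1,\dots,i+j\}$. Then the iterated directional derivative $$(D_{w^*_{\sigma(1)}} \cdots D_{w^*_{\sigma(i+j)}}f ) (x,y)$$ exists and coincides with $$d^{(i,j)}f(x,y,w_1,\dots,w_i,w_{i+1},\dots,w_{i+j}).$$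
   Context: Locally convex spaces are real Hausdorff locally convex topological vector spaces. $D_hf(z):=\lim_{t\to0}t^{-1}(f(z+th)-f(z))$ denotes the directional derivative. For $U\subseteq E_1$, $V\subseteq E_2$ open, $f\colon U\times V\to F$ is $C^{r,s}$ if for all $i,j\in\mathbb{N}_0$ with $i\le r$, $j\le s$ the iterated directional derivative $$d^{(i,j)}f(x,y,w_1,\dots,w_i,v_1,\dots,v_j):=(D_{(w_i,0)}\cdots D_{(w_1,0)}D_{(0,v_j)}\cdots D_{(0,v_1)}f)(x,y)$$ exists for all $x\in U$, $y\in V$, $w_a\in E_1$, $v_b\in E_2$ and the map $d^{(i,j)}f\colon U\times V\times E_1^i\times E_2^j\to F$ is continuous. *)

(* Defs.v *)
From HB Require Import structures.
From mathcomp Require Import all_boot all_order all_fingroup all_algebra.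
From mathcomp Require Import all_classical all_reals all_analysis.

Set Implicit Arguments.
Unset Strict Implicit.
Unset Printing Implicit Defensive.

Import Order.TTheory GRing.Theory Num.Theory.
Import numFieldNormedType.Exports.

Local Open Scope classical_set_scope.
Local Open Scope ring_scope.

(* [derive] and [derivable] of MathComp-Analysis require normed modules; these
   are the same difference quotient and limit for locally convex spaces. As
   [lim] needs a pointed codomain, which [tvsType] does not provide, the limit
   is picked with [xget], with default value 0.
   A function defined on an open set W is represented by a total function: the
   value and the existence of a directional derivative at a point of W depend
   only on the restriction of the function to W. *)
Section DirectionalDerivative.
Context {R : realType} {E F : tvsType R}.
Implicit Types (f : E -> F) (h z : E) (hs : seq E) (W : set E).

Definition dquot f h z : R -> F := fun t => t^-1 *: (f (z + t *: h) - f z).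

Definition dderivable h f z : Prop :=
  exists l : F, dquot f h z @ 0^' --> l.

Definition dderive h f : E -> F :=
  fun z => xget (0 : F) [set l | dquot f h z @ 0^' --> l].

(* The head of the sequence is the outermost (last taken) derivative:
   iter_dderive [:: h1; ...; hn] f = D_h1 (... (D_hn f)). *)
Definition iter_dderive hs f : E -> F := foldr dderive f hs.

(* D_h1 (... (D_hn f)) exists at z: D_h2 (... (D_hn f)) is defined on all of
   the domain W of f, and has a derivative at z in the direction h1. *)
Fixpoint iter_dderivable W hs f z : Prop :=
  if hs is h :: hs' then
    (forall z', W z' -> iter_dderivable W hs' f z') /\
    dderivable h (iter_dderive hs' f) z
  else True.

End DirectionalDerivative.

(* The extended natural number infinity is encoded by None. *)
Definition le_ext (k : nat) (r : option nat) : bool :=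
  if r is Some n then (k <= n)%N else true.

Section Crs.
Context {R : realType} {E1 E2 F : tvsType R}.

(* (w_i, 0), ..., (w_1, 0), (0, v_j), ..., (0, v_1) *)
Definition dij_dirs (i j : nat) (w : 'I_i -> E1) (v : 'I_j -> E2) :
    seq (E1 * E2) :=
  rev [seq (w a, 0) | a <- enum 'I_i] ++ rev [seq (0, v b) | b <- enum 'I_j].

Definition dij (i j : nat) (f : E1 * E2 -> F) (x : E1) (y : E2)
    (w : 'I_i -> E1) (v : 'I_j -> E2) : F :=
  iter_dderive (dij_dirs w v) f (x, y).

Definition is_Crs (r s : option nat) (U : set E1) (V : set E2)
    (f : E1 * E2 -> F) : Prop :=
  forall i j : nat, le_ext i r -> le_ext j s ->
    (forall x y (w : 'I_i -> E1) (v : 'I_j -> E2), U x -> V y ->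
       iter_dderivable (U `*` V) (dij_dirs w v) f (x, y)) /\
    {within (U `*` V) `*` setT, continuous
       (fun p : (E1 * E2) * (prod_topology (fun _ : 'I_i => E1) *
                             prod_topology (fun _ : 'I_j => E2)) =>
          dij f p.1.1 p.1.2 p.2.1 p.2.2)}.

Definition wstar (i j : nat) (w : 'I_i -> E1) (v : 'I_j -> E2)
    (k : 'I_(i + j)) : E1 * E2 :=
  match fintype.split k with
  | inl a => (w a, 0)
  | inr b => (0, v b)
  end.

End Crs.

(* Main.v *)
Require Import Defs.
From HB Require Import structures.
From mathcomp Require Import all_boot all_order all_fingroup all_algebra.
From mathcomp Require Import all_classical all_reals all_analysis.
From mathcomp Require Import lra.

(** The order of differentiation does not matter because of Peano's form of Schwarz' theorem: if D_a f
    and D_b f exist near z, and D_a D_b f exists near z and is continuous at z,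
    then D_b D_a f exists at z and equals D_a D_b f there ([schwarz]). The point
    is that the existence of D_b D_a f is a conclusion, whereas the C^{r,s}
    property grants existence and continuity only of those iterated derivatives
    that differentiate in the second variable first.

    In a locally convex space F, Schwarz' theorem comes from a mean value theorem
    without functionals: if the derivative of a curve stays in an open convex set
    D, then so do its difference quotients ([mean_value]). Applied twice, it puts
    the mixed second difference quotient
      (f(z+ta+sb) - f(z+ta) - f(z+sb) + f(z)) / (ts)
    into any convex neighbourhood of D_a D_b f(z), for all small nonzero t and s;
    letting t tend to 0 and then s gives the claim.

    The rest is an induction on the length of a word of directions
    ([word_deriv_perm]). Among the rearrangements of a word there is a sorted
    one, c N, whose derivative exists and is continuous by hypothesis. Compare it
    with a given rearrangement h L. If h = c, then L rearranges N, and the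
    induction hypothesis says that the derivatives along L and N agree. If not,
    then L rearranges c M and N rearranges h M for the same word M, so that
    D_h D_L f = D_h D_c D_M f and D_c D_N f = D_c D_h D_M f, and the first of
    these exists and equals the second by Schwarz' theorem applied to D_M f. *)
Set Implicit Arguments.
Unset Strict Implicit.
Unset Printing Implicit Defensive.

Import Order.TTheory GRing.Theory Num.Theory.
Import numFieldNormedType.Exports.
Local Open Scope classical_set_scope.
Local Open Scope ring_scope.

(** * A mean value theorem with values in a convex set *)

Lemma convex_set_comb (R : realType) (F : lmodType R) (D : set F) (x y : F)
    (t : R) : convex_set D -> D x -> D y -> 0 <= t <= 1 ->
  D (t *: x + (1 - t) *: y).
Proof.
move=> cD Dx Dy t01.
case/andP: t01 => t0 t1.
exact: set_mem (cD x y (Itv01 t0 t1) (mem_set Dx) (mem_set Dy)).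
Qed.

(** The slope over [a, y] is the convex combination of the slopes over [a, x]
    and [x, y], weighted by the lengths of these intervals. *)
Lemma slope_chain (R : realType) (F : lmodType R) (D : set F) (c : R -> F)
    (a x y : R) : convex_set D -> a < x -> x < y ->
  D ((x - a)^-1 *: (c x - c a)) -> D ((y - x)^-1 *: (c y - c x)) ->
  D ((y - a)^-1 *: (c y - c a)).
Proof.
move=> cD ax xy Dx Dy.
have ya0 : y - a != 0 by apply/lt0r_neq0; lra.
have xa0 : x - a != 0 by apply/lt0r_neq0; lra.
have yx0 : y - x != 0 by apply/lt0r_neq0; lra.
have t01 : 0 <= (x - a) / (y - a) <= 1.
  by rewrite ler_pdivlMr ?ler_pdivrMr; [apply/andP; split; lra|lra|lra].
have := convex_set_comb cD Dx Dy t01.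
have -> : 1 - (x - a) / (y - a) = (y - x) / (y - a).
  by rewrite -[1](divff ya0) -mulrBl; congr (_ / _); lra.
rewrite !scalerA mulrAC divff// mul1r mulrAC divff// mul1r -scalerDr.
by rewrite (addrC (c x - c a)) subrKA.
Qed.

(** The hypothesis says that near each point s all slopes with one end at s lie
    in D. By [slope_chain], slopes over adjacent intervals can be glued, so that
    the set of the u for which the slope over [0, u] lies in D contains its
    supremum and does not stop before t. No topology of F enters. *)
Lemma mean_value_curve (R : realType) (F : lmodType R) (D : set F) (c : R -> F)
    (t : R) : convex_set D -> 0 < t ->
  (forall s, 0 <= s <= t -> exists2 d, 0 < d & forall e, e != 0 -> `|e| < d ->
     D (e^-1 *: (c (s + e) - c s))) ->
  D (t^-1 *: (c t - c 0)).
Proof.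
move=> cD t0 loc.
(* The slope over the degenerate interval [0, 0] is 0, which need not lie in D. *)
pose S := [set u | 0 <= u <= t /\ (u = 0 \/ D ((u - 0)^-1 *: (c u - c 0)))].
have S0 : S 0 by split; [rewrite lexx ltW|left].
have ubS : ubound S t by move=> u [/andP[]].
have hsS : has_sup S by split; [exists 0|exists t].
have supt : sup S <= t by apply: ge_sup => //; exists 0.
have sup0 : 0 <= sup S by apply: sup_upper_bound.
have [|d d0 dD] := loc (sup S); first by rewrite sup0.
have extend x y : S x -> x < y <= t -> D ((y - x)^-1 *: (c y - c x)) -> S y.
  move=> [/andP[x0 xt] Sx] /andP[xy yt] Dy; split; first by apply/andP; split; lra.
  right; case: Sx => [x00|Sx]; first by rewrite -x00.
  have [x00|xn0] := eqVneq x 0; first by rewrite -x00.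
  by apply: (@slope_chain _ _ D c 0 x y) => //; rewrite lt_neqAle eq_sym xn0.
have Ssup : S (sup S).
  have [x Sx xd] := sup_adherent d0 hsS.
  have [xs|xs] := eqVneq x (sup S); first by rewrite -xs.
  have xle : x <= sup S by apply: sup_upper_bound.
  have xlt : x < sup S by rewrite lt_neqAle xs.
  apply: (extend x) => //; first by rewrite xlt.
  have -> : (sup S - x)^-1 *: (c (sup S) - c x) =
            (x - sup S)^-1 *: (c (sup S + (x - sup S)) - c (sup S)).
    by rewrite subrKC -(opprB x) invrN scaleNr -scalerN opprB.
  by apply: dD; [rewrite subr_eq0|rewrite ltr0_norm ?subr_lt0//; lra].
have [st|st] := eqVneq (sup S) t.
  move: Ssup; rewrite st => -[_ []]; last by rewrite subr0.
  by move=> te; move: t0; rewrite te ltxx.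
have slt : sup S < t by rewrite lt_neqAle st.
pose e := Num.min (t - sup S) (d / 2).
have e0 : 0 < e by rewrite lt_min; apply/andP; split; lra.
have ed : e <= d / 2 by rewrite ge_min lexx orbT.
have et : e <= t - sup S by rewrite ge_min lexx.
have : S (sup S + e).
  apply: (extend (sup S)) => //; first by apply/andP; split; lra.
  rewrite [X in X^-1]addrC addKr.
  by apply: dD; [rewrite gt_eqF|rewrite gtr0_norm//; lra].
move=> /(sup_upper_bound hsS); lra.
Qed.

(** * Schwarz' theorem in locally convex spaces *)

Section DirectionalDerivatives.
Context {R : realType} {E F : tvsType R}.
Implicit Types (f : E -> F) (D : set F) (h z : E).

Lemma cvg_dderive h f z :
  dderivable h f z -> dquot f h z @ 0^' --> dderive h f z.
Proof. by move=> fh; exact: (@xgetPex F 0 [set l | dquot f h z @ 0^' --> l]). Qed.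

Lemma cvg_dderiveE (hF : hausdorff_space F) h f z l :
  dquot f h z @ 0^' --> l -> dderive h f z = l.
Proof.
move=> fl.
have FF : ProperFilter (dquot f h z @ 0^') by apply: fmap_proper_filter.
apply: (@cvg_unique F hF _ FF) => //=; apply: cvg_dderive; by exists l.
Qed.

Lemma cvg_diff_scale (T : Type) (G : set_system T) {FG : Filter G}
    (u v : T -> F) (a b : F) (k : R) :
  u @ G --> a -> v @ G --> b -> (fun t => k *: (u t - v t)) @ G --> k *: (a - b).
Proof.
move=> ua vb.
have uv : (fun t => u t - v t) @ G --> a - b.
  apply: (@continuous2_cvg _ _ _ _ _ FG u v (fun x y => x - y) a b) => //.
  exact: (@sub_continuous F (a, b)).
apply: (@continuous2_cvg _ R^o F _ _ FG (fun=> k) (fun t => u t - v t) (fun x y => x *: y)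
  k (a - b)) => //.
  exact: (scale_continuous (k, a - b)).
exact: cvg_cst.
Qed.

(** As D is open, the local hypothesis of [mean_value_curve] holds as soon as the
    derivatives along the segment from z to z + t h lie in D. *)
Lemma mean_value D f h z (t : R) : open D -> convex_set D -> t != 0 ->
  (forall s, `|s| <= `|t| ->
    exists2 l, D l & dquot f h (z + s *: h) @ 0^' --> l) ->
  D (dquot f h z t).
Proof.
move=> oD cD t0 Df.
(* For negative t the curve runs from z + t h to z, so that time increases. *)
pose m := Num.min 0 t.
have -> : dquot f h z t =
    `|t|^-1 *: (f (z + (m + `|t|) *: h) - f (z + (m + 0) *: h)).
  rewrite /dquot /m; have [tp|tn] := ltP 0 t.
    by rewrite gtr0_norm// add0r addr0 scale0r addr0.
  rewrite ler0_norm// subrr scale0r !addr0.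
  by rewrite invrN scaleNr -scalerN opprB.
apply: (mean_value_curve (c := fun s => f (z + (m + s) *: h))) => //.
  by rewrite normr_gt0.
move=> s /andP[s0 st].
have [|l Dl fl] := Df (m + s).
  by move: st; rewrite /m; have [tp|tn] := ltP 0 t;
    [rewrite add0r (ger0_norm s0)|rewrite (ler0_norm tn) ler_norml => ?; apply/andP; split; lra].
have /= := fl _ (open_nbhs_nbhs (conj oD Dl)).
move=> [d d0 dD]; exists d => // e e0 ed.
rewrite (addrA m) (scalerDl h (m + s)) (addrA z).
apply: (dD e) => //; by rewrite /= sub0r normrN.
Qed.

(** The closure is controlled because the limit t -> 0 in Schwarz' theorem takes
    place inside D; regularity of uniform spaces provides this. *)
Lemma exists_convex_nbhs (l : F) (N : set F) : nbhs l N ->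
  exists D, [/\ open D, convex_set D, D l & closure D `<=` N].
Proof.
move=> /(uniform_regular (a := l)) [K lK KN].
have [B cB [oB bB]] := @locally_convex R F.
have [D [BD Dl] DK] := bB _ _ lK.
exists D; split => //; [exact: oB|exact/cB/mem_set|].
exact: subset_trans (closure_subset DK) KN.
Qed.

Lemma nbhs_plane (P : set E) (a b z : E) : nbhs z P ->
  exists2 d : R, 0 < d & forall t s : R, `|t| < d -> `|s| < d ->
    P (z + s *: b + t *: a).
Proof.
move=> zP.
have cvgZ c (G : set_system (R * R)) (FG : Filter G) (u : R * R -> R) :
    u @ G --> (0 : R) -> (fun p => u p *: c) @ G --> (0 : E).
  move=> u0; rewrite -(scale0r c).
  apply: (@continuous2_cvg _ R^o E _ _ FG u (fun=> c) (fun x y => x *: y) 0 c) => //.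
    exact: (scale_continuous (0, c)).
  exact: cvg_cst.
have addE (G : set_system (R * R)) (FG : Filter G) (u v : R * R -> E) (p q : E) :
    u @ G --> p -> v @ G --> q -> (fun x => u x + v x) @ G --> p + q.
  move=> up vq.
  apply: (@continuous2_cvg _ _ _ _ _ FG u v (fun x y => x + y) p q) => //.
  exact: (add_continuous (p, q)).
have : (fun p : R * R => z + p.2 *: b + p.1 *: a) @ nbhs ((0 : R), (0 : R)) --> z.
  rewrite -[X in _ --> X]addr0 -[X in _ --> X]addr0.
  apply: (addE _ _); last by apply: (cvgZ _ _ _); exact: cvg_fst.
  apply: (addE _ _); last by apply: (cvgZ _ _ _); exact: cvg_snd.
  exact: cvg_cst.
move=> /(_ _ zP) /= [[A B] [/= [d1 d10 dA] [d2 d20 dB]] AB].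
exists (Num.min d1 d2); first by rewrite lt_min d10.
move=> t s; rewrite !lt_min => /andP[td _] /andP[_ sd].
by apply: (AB (t, s)); split; [apply: dA|apply: dB]; rewrite /= sub0r normrN.
Qed.

(** Only the derivative in the order a after b is assumed to be continuous; the
    existence of the other mixed derivative is part of the conclusion. *)
Lemma schwarz f (a b z : E) :
  (\forall p \near z, dderivable a f p) ->
  (\forall p \near z, dderivable b f p) ->
  (\forall p \near z, dderivable a (dderive b f) p) ->
  {for z, continuous (dderive a (dderive b f))} ->
  dquot (dderive a f) b z @ 0^' --> dderive a (dderive b f) z.
Proof.
move=> fa fb fba cont N /exists_convex_nbhs[D [oD cD Dl DN]].
have {}cont := cont _ (open_nbhs_nbhs (conj oD Dl)).
have [d d0 good] := nbhs_plane a b (filterI (filterI fa fb) (filterI fba cont)).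
have good0 s : `|s| < d -> dderivable a f (z + s *: b) /\ dderivable b f (z + s *: b).
  move=> sd; have := good 0 s; rewrite normr0 scale0r addr0.
  by case/(_ d0 sd) => -[].
change (\forall s \near (0 : R)^', N (dquot (dderive a f) b z s)).
near=> s; apply: DN.
have s0 : s != 0 by near: s; exact: nbhs_dnbhs_neq.
have sd : `|s| < d by near: s; exact: dnbhs0_lt.
(* u t is the mixed second difference quotient; it suffices to have it in D for
   all small t, since its limit for t -> 0 is the difference quotient of D_a f. *)
pose u t := s^-1 *: (dquot f a (z + s *: b) t - dquot f a z t).
apply: (@closed_cvg _ _ (0 : R)^' _ u _ (@closed_closure _ D)); last first.
  apply: cvg_diff_scale; apply: cvg_dderive.
    exact: (good0 s sd).1.
  exact: nbhs_singleton fa.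
near=> t; apply: subset_closure.
have t0 : t != 0 by near: t; exact: nbhs_dnbhs_neq.
have td : `|t| < d by near: t; exact: dnbhs0_lt.
(* First in the direction b, for the difference quotient of f in the direction
   a; its derivative is the difference quotient in the direction a of D_b f. *)
apply: (@mean_value D (fun p => dquot f a p t) b z s) => // s' s's.
exists (dquot (dderive b f) a (z + s' *: b) t).
  (* Then in the direction a, for D_b f. *)
  apply: mean_value => // t' t't.
  exists (dderive a (dderive b f) (z + s' *: b + t' *: a)).
    by have [_ []] := good t' s' (le_lt_trans t't td) (le_lt_trans s's sd).
  by apply: cvg_dderive; have [_ []] := good t' s' (le_lt_trans t't td) (le_lt_trans s's sd).
have -> : dquot (fun p => dquot f a p t) b (z + s' *: b) =
    (fun e => t^-1 *: (dquot f b (z + s' *: b + t *: a) e - dquot f b (z + s' *: b) e)).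
  apply/funext => e; rewrite /dquot -!scalerBr !scalerA mulrC; congr (_ *: _).
  rewrite (addrAC _ (e *: b)) !opprB addrACA [RHS]addrACA.
  by congr (_ + _); exact: addrC.
apply: cvg_diff_scale; apply: cvg_dderive.
  by have [[]] := good t s' td (le_lt_trans s's sd).
exact: (good0 s' (le_lt_trans s's sd)).2.
Unshelve. all: by end_near. Qed.

End DirectionalDerivatives.

(** * Directional derivatives are local *)

Section Locality.
Context {R : realType} {E F : tvsType R}.
Variables (W : set E) (oW : open W).
Implicit Types (f g : E -> F) (h z : E).

Lemma cvg_dquot_local f g h z (l : F) : W z -> (forall p, W p -> f p = g p) ->
  dquot f h z @ 0^' --> l -> dquot g h z @ 0^' --> l.
Proof.
move=> Wz fg; apply: cvg_trans; apply: near_eq_cvg.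
have [d d0 Wd] := nbhs_plane h 0 (open_nbhs_nbhs (conj oW Wz)).
near=> t; rewrite /dquot (fg z Wz) fg//.
have := Wd t 0; rewrite normr0 scale0r addr0; apply => //.
by near: t; exact: dnbhs0_lt.
Unshelve. all: by end_near. Qed.

Lemma dderivable_local f g h z : W z -> (forall p, W p -> f p = g p) ->
  dderivable h f z -> dderivable h g z.
Proof. by move=> Wz fg [l fl]; exists l; exact: cvg_dquot_local fl. Qed.

Lemma dderive_local f g h z : W z -> (forall p, W p -> f p = g p) ->
  dderive h f z = dderive h g z.
Proof.
move=> Wz fg; congr (xget 0 _); apply/seteqP; split => l.
  exact: cvg_dquot_local.
by apply: cvg_dquot_local => // p Wp; rewrite fg.
Qed.

Lemma continuous_local f g z : W z -> (forall p, W p -> f p = g p) ->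
  {for z, continuous f} -> {for z, continuous g}.
Proof.
move=> Wz fg; rewrite /prop_for /continuous_at -(fg z Wz).
apply: cvg_trans; apply: near_eq_cvg.
by apply: filterS (open_nbhs_nbhs (conj oW Wz)) => p /fg.
Qed.

End Locality.

(** * Rearranging words of directions *)

Section Words.
Context {R : realType} {E F : tvsType R} (hF : hausdorff_space F).
(* Letters are mapped to directions by dir, which may fail to be injective: the
   zero vector is a direction in either variable. *)
Context {T : eqType} (dir : T -> E) (W : set E) (oW : open W) (f : E -> F).
Implicit Types (L C M N : seq T).

(** The head of the word is the last derivative taken. *)
Definition word_deriv L : E -> F := iter_dderive (map dir L) f.

Definition word_derivable L :=
  forall z, W z -> iter_dderivable W (map dir L) f z.

Definition word_C L :=
  word_derivable L /\ forall z, W z -> {for z, continuous (word_deriv L)}.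

Variable A : seq T -> Prop.
Hypothesis A_perm : forall L M, perm_eq L M -> A L -> A M.
Hypothesis A_tail : forall a L, A (a :: L) -> A L.
Hypothesis A_C : forall L, A L -> exists2 C, perm_eq L C & word_C C.

(** A collects the words whose derivatives are wanted. Each of them has some
    rearrangement with a continuous derivative, and one comparison with such a
    rearrangement settles both existence and value; two rearrangements of the
    same word are then equal because they are compared with the same one. *)
Lemma word_deriv_perm L C : A L -> perm_eq L C -> word_C C ->
  word_derivable L /\ forall z, W z -> word_deriv L z = word_deriv C z.
Proof.
elim: {L}(size L) {-2}L (erefl (size L)) C => [|n IH] L sL C AL LC goodC.
  have L0 := size0nil sL; move: LC; rewrite L0 perm_sym => /perm_nilP ->.
  by split.
have IHd M : size M = n -> A M -> word_derivable M.
  by move=> sM AM; have [C' MC gC'] := A_C AM; have [] := IH _ sM _ AM MC gC'.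
have IHp M N : size M = n -> A M -> perm_eq M N ->
    forall z, W z -> word_deriv M z = word_deriv N z.
  move=> sM AM MN z Wz; have [C' MC gC'] := A_C AM.
  rewrite (IH _ sM _ AM MC gC').2//.
  have NC : perm_eq N C' by rewrite perm_sym in MN; exact: perm_trans MC.
  by rewrite (IH _ _ _ (A_perm MN AM) NC gC').2// -(perm_size MN).
case: L sL AL LC => // h L [sL] AL LC.
have AL' := A_tail AL.
suff key z : W z -> dderivable (dir h) (word_deriv L) z /\
    dderive (dir h) (word_deriv L) z = word_deriv C z.
  by split => z Wz; [split; [exact: IHd|exact: (key z Wz).1]|exact: (key z Wz).2].
move=> Wz; case: C LC goodC => [/perm_nilP//|c N] LC [derC contC].
have AN : A N by apply: (@A_tail c); exact: A_perm AL.
have sN : size N = n by have := perm_size LC; move=> /= [] <-.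
have derN p (Wp : W p) : dderivable (dir c) (word_deriv N) p := (derC p Wp).2.
have [hc|hc] := eqVneq h c.
  subst c; rewrite perm_cons in LC.
  have LN := IHp _ _ sL AL' LC.
  split; last exact: (dderive_local oW (dir h) Wz LN).
  by apply: (dderivable_local oW Wz _ (derN _ Wz)) => p Wp; rewrite LN.
(* The last derivatives taken differ: exchange them by Schwarz' theorem, applied
   to the derivative along the remaining letters M. *)
have cL : c \in L.
  by have := perm_mem LC c; rewrite !inE eqxx eq_sym (negPf hc).
pose M := rem c L.
have LcM : perm_eq L (c :: M) := perm_to_rem cL.
have NhM : perm_eq N (h :: M).
  rewrite -(perm_cons c) -(permPl LC).
  have /permPr <- := permEl (perm_catCA [:: h] [:: c] M).
  by rewrite /= perm_cons.
have LM := IHp _ _ sL AL' LcM.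
have NM := IHp _ _ sN AN NhM.
have AcM : A (c :: M) := A_perm LcM AL'.
have AhM : A (h :: M) := A_perm NhM AN.
have scM : size (c :: M) = n by rewrite -(perm_size LcM).
have shM : size (h :: M) = n by rewrite -(perm_size NhM).
have WW := open_nbhs_nbhs (conj oW Wz).
have sch : dquot (dderive (dir c) (word_deriv M)) (dir h) z @ 0^' -->
    dderive (dir c) (dderive (dir h) (word_deriv M)) z.
  apply: schwarz.
  - by apply: filterS WW => p Wp; exact: (IHd _ scM AcM p Wp).2.
  - by apply: filterS WW => p Wp; exact: (IHd _ shM AhM p Wp).2.
  - apply: filterS WW => p Wp; exact: (dderivable_local oW Wp NM (derN _ Wp)).
  - apply: (continuous_local oW Wz _ (contC z Wz)) => p Wp.
    by rewrite /word_deriv /= (dderive_local oW (dir c) Wp NM).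
have {}sch : dquot (word_deriv L) (dir h) z @ 0^' --> word_deriv (c :: N) z.
  rewrite [word_deriv (c :: N) z](dderive_local oW _ Wz NM).
  by apply: (cvg_dquot_local oW Wz _ sch) => p Wp; rewrite LM.
split; first by eexists; exact: sch.
exact: cvg_dderiveE.
Qed.

End Words.

(** * Words in two variables *)

Lemma open_setX (X Y : topologicalType) (A : set X) (B : set Y) :
  open A -> open B -> open (A `*` B).
Proof.
rewrite !openE => oA oB [x y] [/= /oA Ax /oB By].
by exists (A, B).
Qed.

Lemma perm_enum_ord n (s : seq 'I_n) :
  size s = n -> (forall k, k \in s) -> perm_eq s (enum 'I_n).
Proof.
move=> sn sE; apply: uniq_perm; last by move=> k; rewrite sE mem_enum.
  apply: (leq_size_uniq (enum_uniq 'I_n)) => [k _|]; first exact: sE.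
  by rewrite sn size_enum_ord.
exact: enum_uniq.
Qed.

Section Tagged.
Context {R : realType} {E1 E2 F : tvsType R}.

(** A letter remembers the variable to which its direction belongs, so that the
    derivatives in each variable can be counted even if some direction is 0. *)
Definition dir_of (t : E1 + E2) : E1 * E2 :=
  match t with inl a => (a, 0) | inr b => (0, b) end.

Definition is_inl (t : E1 + E2) : bool := if t is inl _ then true else false.

Definition admissible (r s : option nat) (L : seq (E1 + E2)) : Prop :=
  le_ext (count is_inl L) r /\ le_ext (count (predC is_inl) L) s.

Lemma le_ext_leq m n r : (m <= n)%N -> le_ext n r -> le_ext m r.
Proof. by case: r => //= k; exact: leq_trans. Qed.

Lemma count_sorted_word (ws : seq E1) (vs : seq E2) :
  let L := map inl ws ++ map inr vs in
  count is_inl L = size ws /\ count (predC is_inl) L = size vs.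
Proof.
rewrite /= !count_cat !count_map.
by rewrite -[X in (X + _ = _)%N /\ _]/(count predT ws) -[X in _ /\ (_ + X = _)%N]/(count predT vs)
  -[X in (_ + X = _)%N /\ _]/(count pred0 vs) -[X in _ /\ (X + _ = _)%N]/(count pred0 ws)
  !count_predT !count_pred0 addn0.
Qed.

Lemma perm_sorted_word (L : seq (E1 + E2)) :
  exists ws vs, perm_eq L (map inl ws ++ map inr vs).
Proof.
elim: L => [|[a|b] L [ws [vs LC]]]; first by exists [::], [::].
- by exists (a :: ws), vs; rewrite /= perm_cons.
- exists ws, (b :: vs).
  by rewrite perm_sym perm_catC /= perm_cons perm_catC perm_sym.
Qed.

(** The families of directions in [dij_dirs] are listed from the first derivative
    taken to the last, hence the reversals. *)
Lemma dij_dirs_nth (ws : seq E1) (vs : seq E2) :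
  dij_dirs (fun a : 'I_(size ws) => nth 0 (rev ws) a)
           (fun b : 'I_(size vs) => nth 0 (rev vs) b) =
  map dir_of (map inl ws ++ map inr vs).
Proof.
have enumE (X S : Type) (x0 : X) (g : X -> S) (xs : seq X) :
    [seq g (nth x0 (rev xs) a) | a : 'I_(size xs) <- enum 'I_(size xs)] =
    map g (rev xs).
  have -> : map g (rev xs) = map g (mkseq (nth x0 (rev xs)) (size xs)).
    by rewrite -(size_rev xs) mkseq_nth.
  by rewrite /mkseq -val_enum_ord -!map_comp.
rewrite /dij_dirs (enumE _ _ _ (fun x => (x, 0 : E2))).
rewrite (enumE _ _ _ (fun x => (0 : E1, x))) !map_rev !revK.
by rewrite map_cat -!map_comp.
Qed.

(** Sorted words are those about which the C^{r,s} property speaks; continuity in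
    the point alone follows by fixing the directions. *)
Lemma Crs_sorted_word r s (U : set E1) (V : set E2) (f : E1 * E2 -> F) ws vs :
  open U -> open V -> is_Crs r s U V f ->
  le_ext (size ws) r -> le_ext (size vs) s ->
  word_C dir_of (U `*` V) f (map inl ws ++ map inr vs).
Proof.
move=> oU oV hf hr hs; have [derf contf] := hf _ _ hr hs.
rewrite /word_C /word_derivable /word_deriv -dij_dirs_nth.
split=> [[x y] [Ux Vy]|z Wz]; first exact: derf.
move: contf; rewrite continuous_open_subspace; last first.
  by apply: open_setX; [exact: open_setX|exact: openT].
set w := fun a : 'I_(size ws) => nth (0 : E1) (rev ws) a.
set v := fun b : 'I_(size vs) => nth (0 : E2) (rev vs) b.
pose W := prod_topology (fun _ : 'I_(size ws) => E1).
pose V' := prod_topology (fun _ : 'I_(size vs) => E2).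
move=> /(_ (z, ((w : W), (v : V')))); rewrite inE => /(_ (conj Wz I)) cont.
have -> : iter_dderive (dij_dirs w v) f =
  (fun p : (E1 * E2) * (W * V') => dij f p.1.1 p.1.2 p.2.1 p.2.2) \o
  (fun z => (z, ((w : W), (v : V')))).
  by apply/funext => -[x y].
apply: continuous_comp; last exact: cont.
have cwv : (fun _ : E1 * E2 => ((w : W), (v : V'))) @ z --> ((w : W), (v : V')).
  exact: cvg_cst.
exact: (cvg_pair (@cvg_id _ (nbhs z)) cwv).
Qed.

Definition wtag (i j : nat) (w : 'I_i -> E1) (v : 'I_j -> E2) (k : 'I_(i + j)) :
    E1 + E2 :=
  match fintype.split k with inl a => inl (w a) | inr b => inr (v b) end.

Lemma dir_of_wtag i j (w : 'I_i -> E1) (v : 'I_j -> E2) k :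
  dir_of (wtag w v k) = wstar w v k.
Proof. by rewrite /wtag /wstar; case: fintype.split. Qed.

(** The right-hand side is the word of the directions [dij_dirs w v]. *)
Lemma perm_wtag i j (w : 'I_i -> E1) (v : 'I_j -> E2) (sigma : 'S_(i + j)) :
  perm_eq [seq wtag w v (sigma k) | k <- enum 'I_(i + j)]
    (map inl (rev [seq w a | a <- enum 'I_i]) ++
     map inr (rev [seq v b | b <- enum 'I_j])).
Proof.
have -> : [seq wtag w v (sigma k) | k <- enum 'I_(i + j)] =
    map (wtag w v) (map sigma (enum 'I_(i + j))).
  exact: (map_comp (wtag w v) sigma).
rewrite !map_rev -(map_comp inl w) -(map_comp inr v).
have permE : perm_eq (map sigma (enum 'I_(i + j)))
    (map (lshift j) (enum 'I_i) ++ map (@rshift i j) (enum 'I_j)).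
  apply: (@perm_trans _ (enum 'I_(i + j))).
    apply: perm_enum_ord => [|k]; first by rewrite size_map size_enum_ord.
    by apply/mapP; exists (sigma^-1%g k); rewrite ?mem_enum ?permKV.
  rewrite perm_sym; apply: perm_enum_ord => [|k].
    by rewrite size_cat (size_map (lshift j)) (size_map (@rshift i j)) !size_enum_ord.
  rewrite mem_cat -(splitK k); case: fintype.split => a; apply/orP; [left|right];
    by apply: map_f; rewrite mem_enum.
apply: perm_trans (perm_map _ permE) _; rewrite map_cat.
rewrite -(map_comp _ (lshift j)) -(map_comp _ (@rshift i j)).
rewrite (eq_map (g := inl \o w)); last first.
  by move=> a /=; rewrite /wtag (unsplitK (inl a)).
rewrite (eq_map (f := _ \o _) (g := inr \o v)); last first.
  by move=> a /=; rewrite /wtag (unsplitK (inr a)).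
by apply: perm_cat; rewrite perm_sym perm_rev.
Qed.

End Tagged.

Theorem theorem3p6 (R : realType) (E1 E2 F : tvsType R)
  (hE1 : hausdorff_space E1) (hE2 : hausdorff_space E2)
  (hF : hausdorff_space F)
  (r s : option nat) (U : set E1) (V : set E2) (oU : open U) (oV : open V)
  (f : E1 * E2 -> F) (hf : is_Crs r s U V f)
  (i j : nat) (hi : le_ext i r) (hj : le_ext j s)
  (x : E1) (y : E2) (hx : U x) (hy : V y)
  (w : 'I_i -> E1) (v : 'I_j -> E2) (sigma : 'S_(i + j)) :
  let dirs := [seq wstar w v (sigma k) | k <- enum 'I_(i + j)] in
  iter_dderivable (U `*` V) dirs f (x, y) /\
  iter_dderive dirs f (x, y) = dij f x y w v.
Proof.
move=> dirs.
pose L := [seq wtag w v (sigma k) | k <- enum 'I_(i + j)].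
have -> : dirs = map dir_of L.
  by rewrite -(map_comp dir_of); apply: eq_map => k /=; rewrite dir_of_wtag.
set ws := rev [seq w a | a <- enum 'I_i]; set vs := rev [seq v b | b <- enum 'I_j].
have sws : size ws = i by rewrite size_rev size_map size_enum_ord.
have svs : size vs = j by rewrite size_rev size_map size_enum_ord.
have LC : perm_eq L (map inl ws ++ map inr vs) := perm_wtag w v sigma.
have AL : admissible r s L.
  rewrite /admissible !(seq.permP LC).
  by have [-> ->] := count_sorted_word ws vs; rewrite sws svs.
have [M N MN [Mr Ms]|t M [Mr Ms]|M [Mr Ms]||derL derLE] :=
    @word_deriv_perm R (E1 * E2)%type F hF _ dir_of (U `*` V) (open_setX oU oV) f
      (admissible r s) _ _ _ L _ AL LC.
- by rewrite /admissible -!(seq.permP MN).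
- by split; [apply: le_ext_leq Mr|apply: le_ext_leq Ms]; rewrite /= leq_addl.
- have [ws' [vs' MC]] := perm_sorted_word M.
  have [cM cM'] := count_sorted_word ws' vs'.
  exists (map inl ws' ++ map inr vs') => //.
  by apply: Crs_sorted_word hf _ _ => //; rewrite -?cM -?cM' -(seq.permP MC).
- by apply: Crs_sorted_word hf _ _ => //; rewrite ?sws ?svs.
split; first exact: derL.
rewrite [LHS]derLE // /word_deriv /dij; congr (iter_dderive _ f _).
by rewrite /dij_dirs map_cat /ws /vs !map_rev -!(map_comp dir_of) -(map_comp _ w) -(map_comp _ v).
Qed.
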